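(* Let $G_1$ be a connected graph on $n_1$ vertices and $m_1$ edges and let $G_2$ be a graph on $n_2$ vertices and $m_2$ edges, with vertex degrees $d_1,\dots,d_{n_2}$ and Laplacian eigenvalues $\mu_1(G_2),\dots,\mu_{n_2}(G_2)$. Let $Q=L_{G_2}+2I_{n_2}$, $D_{G_2}=\mathrm{diag}(d_1,\dots,d_{n_2})$, $A_{G_2}$ the adjacency matrix of $G_2$, and $\pi=(d_1,\dots,d_{n_2})^T$. Then \begin{align*} Kf(G_1\diamondsuit G_2)&=n_1(1+n_2+m_2)\Big[\frac{n_1m_2}{2}+\frac{n_1}{2}\big(\mathrm{tr}(Q^{-1}A_{G_2})+\mathrm{tr}(Q^{-1}D_{G_2})\big)+2n_1\sum_{i=1}^{n_2}\frac{1}{\mu_i(G_2)+2}\\ &\qquad+\frac{m_2+n_2+1}{n_1}Kf(G_1)\Big]-\frac{n_1}{2}\,\pi^TQ^{-1}\pi-\frac{5n_1m_2+2n_1n_2}{2}. \end{align*}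
   Context: All graphs are simple and undirected; $L_G=D_G-A_G$ is the Laplacian matrix. The resistance distance between two vertices of a connected graph is the effective resistance between them when every edge is a unit resistor, and the Kirchhoff index $Kf(G)$ of a connected graph is the sum of resistance distances over all unordered pairs of distinct vertices. The corona-vertex of the subdivision graph $G_1\diamondsuit G_2$ is obtained from $G_1$ and $|V(G_1)|$ vertex-disjoint copies of the subdivision graph $S(G_2)$ (the graph obtained from $G_2$ by inserting a new vertex into every edge) by joining the $i$-th vertex of $G_1$ to every original vertex (i.e. vertex coming from $V(G_2)$, not a subdivision vertex) of the $i$-th copy. It has $n_1(1+n_2+m_2)$ vertices. *)

(* Defs.v *)
From HB Require Import structures.
From mathcomp Require Import all_boot all_order all_algebra.
Set Implicit Arguments. Unset Strict Implicit. Unset Printing Implicit Defensive.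
Import Order.TTheory GRing.Theory Num.Theory.
Local Open Scope ring_scope.

(* A simple graph on a finite vertex type T is a symmetric irreflexive
   relation e : rel T (symmetry/irreflexivity are hypotheses of the theorem). *)

Section Graphs.
Variable R : realFieldType.

Definition deg (T : finType) (e : rel T) (x : T) : nat := #|[set y | e x y]|.

Definition connected (T : finType) (e : rel T) : Prop := forall x y : T, connect e x y.

Definition adj_mx (n : nat) (e : rel 'I_n) : 'M[R]_n :=
  \matrix_(i, j) (e i j)%:R.
Definition deg_mx (n : nat) (e : rel 'I_n) : 'M[R]_n :=
  diag_mx (\row_i (deg e i)%:R).
Definition lap_mx (n : nat) (e : rel 'I_n) : 'M[R]_n := deg_mx e - adj_mx e.
Definition deg_vec (n : nat) (e : rel 'I_n) : 'cV[R]_n := \col_i (deg e i)%:R.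

Definition lapT (T : finType) (e : rel T) : 'M[R]_#|T| :=
  \matrix_(i, j) (if i == j then (deg e (enum_val i))%:R
                  else - (e (enum_val i) (enum_val j))%:R).

(* Resistance distance: the potential difference v_x - v_y of a solution v of
   Kirchhoff's equations  v L = e_x - e_y  (unit current injected at x and
   extracted at y, all edges unit resistors).  A solution is produced by
   pinvmx; for a connected graph the difference does not depend on the
   chosen solution. *)
Definition resistance (T : finType) (e : rel T) (x y : T) : R :=
  let b : 'rV[R]_#|T| := delta_mx 0 (enum_rank x) - delta_mx 0 (enum_rank y) in
  let v := b *m pinvmx (lapT e) in
  v 0 (enum_rank x) - v 0 (enum_rank y).

Definition Kf (T : finType) (e : rel T) : R :=
  \sum_(x : T) \sum_(y : T | (enum_rank x < enum_rank y)%N) resistance e x y.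

End Graphs.

Definition edge_pred (n : nat) (e : rel 'I_n) : pred ('I_n * 'I_n) :=
  fun p => (p.1 < p.2)%N && e p.1 p.2.
Definition edge (n : nat) (e : rel 'I_n) := {p : 'I_n * 'I_n | edge_pred e p}.

(* Vertices of the corona-vertex of the subdivision graph G1 <> G2:
   inl a           : vertex a of G1
   inr (i, inl u)  : original vertex u of the i-th copy of S(G2)
   inr (i, inr f)  : subdivision vertex of edge f in the i-th copy of S(G2) *)
Definition cvert (n1 n2 : nat) (e2 : rel 'I_n2) : finType :=
  ('I_n1 + ('I_n1 * ('I_n2 + edge e2)))%type.

Definition corona_rel (n1 n2 : nat) (e1 : rel 'I_n1) (e2 : rel 'I_n2) :
  rel (cvert n1 e2) :=
  fun x y =>
    match x, y with
    | inl a, inl b => e1 a b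
    | inl a, inr (i, inl _) => a == i
    | inr (i, inl _), inl a => a == i
    | inr (i, inl u), inr (j, inr f) => (i == j) && ((u == (val f).1) || (u == (val f).2))
    | inr (j, inr f), inr (i, inl u) => (i == j) && ((u == (val f).1) || (u == (val f).2))
    | _, _ => false
    end.
Arguments corona_rel {n1 n2} e1 e2 _ _.

(* Main.v *)
(* Each copy of S(G2) hangs at the cut vertex i of G1, so the resistance between
   two vertices of the corona splits into the resistance in G1 between their
   roots and a part governed by the Green function M of a single copy with
   grounded root.  Summing over pairs, with N = 1 + n2 + m2,
     Kf = n1^2 N tr M - n1 (1^T M 1) + N^2 Kf(G1).
   Eliminating the subdivision vertices (Schur complement) expresses M through
   Q^-1, and both tr M and 1^T M 1 follow from Q 1 = 2 1. *)
Require Import Defs.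
From HB Require Import structures.
From mathcomp Require Import all_boot all_order all_algebra.
From mathcomp Require Import ring lra.
Import Order.TTheory GRing.Theory Num.Theory.
Local Open Scope ring_scope.

Set Implicit Arguments.
Unset Strict Implicit.
Unset Printing Implicit Defensive.

(** * The Laplacian operator and its kernel *)

(** Net current leaving [z] under the potential [g]. Working with functions on [T] avoids the
    [enum_rank] indexing of [lapT], so sums can follow the sum-type structure of the corona. *)
Definition laplacian (R : realFieldType) (T : finType) (e : rel T) (g : T -> R)
  (z : T) : R := \sum_w (e z w)%:R * (g z - g w).

Lemma natr_deg (R : realFieldType) (T : finType) (e : rel T) (z : T) :
  (deg e z)%:R = \sum_w (e z w)%:R :> R.
Proof.
rewrite /deg -sum1_card natr_sum big_mkcond /=.
by apply: eq_bigr => w _; rewrite inE; case: (e z w).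
Qed.

Lemma laplacianD (R : realFieldType) (T : finType) (e : rel T) (f g : T -> R) z :
  laplacian e (fun w => f w + g w) z = laplacian e f z + laplacian e g z.
Proof. by rewrite -big_split /=; apply: eq_bigr => w _; ring. Qed.

Lemma laplacianB (R : realFieldType) (T : finType) (e : rel T) (f g : T -> R) z :
  laplacian e (fun w => f w - g w) z = laplacian e f z - laplacian e g z.
Proof. by rewrite -sumrB; apply: eq_bigr => w _; ring. Qed.

(** Exchanging [z] and [w] in one of two copies of the double sum pairs [g z * (g z - g w)] with
    [g w * (g w - g z)], and these add up to a square. *)
Lemma dirichlet_energy (R : realFieldType) (T : finType) (e : rel T) (g : T -> R) :
  symmetric e ->
  2 * \sum_z g z * laplacian e g z =
  \sum_z \sum_w (e z w)%:R * (g z - g w) ^+ 2.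
Proof.
move=> es.
have E : \sum_z g z * laplacian e g z =
    \sum_z \sum_w (e z w)%:R * (g z * (g z - g w)).
  apply: eq_bigr => z _; rewrite mulr_sumr; apply: eq_bigr => w _; ring.
rewrite mulr_natl mulr2n {1}E E [X in X + _]exchange_big -big_split /=.
apply: eq_bigr => z _; rewrite -big_split /=; apply: eq_bigr => w _.
by rewrite es; ring.
Qed.

(** A harmonic function has zero Dirichlet energy. Every nonnegative summand then vanishes, so [g]
    agrees across each edge and hence along paths. *)
Lemma harmonic_const (R : realFieldType) (T : finType) (e : rel T) (g : T -> R) :
  symmetric e -> connected e -> (forall z, laplacian e g z = 0) ->
  forall x y, g x = g y.
Proof.
move=> es ec g0.
have := dirichlet_energy g es.
rewrite big1 ?mulr0 => [/esym E0|z _]; last by rewrite g0 mulr0.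
have ge0 z w : 0 <= (e z w)%:R * (g z - g w) ^+ 2.
  by rewrite mulr_ge0 ?sqr_ge0.
have step z w : e z w -> g z = g w.
  move=> ezw; apply/eqP; rewrite -subr_eq0 -sqrf_eq0.
  have /eqP := psumr_eq0P (fun w _ => ge0 z w)
    (psumr_eq0P (fun z _ => sumr_ge0 _ (fun w _ => ge0 z w)) E0 (i := z) isT)
    (i := w) isT.
  by rewrite ezw mul1r.
move=> x y; have /connectP[p] := ec x y.
elim: p x => [|a p IH] x /=; first by move=> _ ->.
by case/andP=> /step -> /IH; apply.
Qed.

(** * Resistance and Kirchhoff index through potentials *)

Lemma mulmx_lapT (R : realFieldType) (T : finType) (e : rel T) (v : 'rV[R]_#|T|) z :
  symmetric e -> irreflexive e ->
  (v *m lapT R e) 0 (enum_rank z) = laplacian e (fun w => v 0 (enum_rank w)) z.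
Proof.
move=> es ei; rewrite mxE.
rewrite (reindex_onto (@enum_rank T) enum_val) /=; last first.
  by move=> i _; rewrite enum_valK.
under eq_bigl do rewrite enum_rankK eqxx.
rewrite /laplacian [RHS](eq_bigr (fun w => v 0 (enum_rank z) * (e z w)%:R
   - v 0 (enum_rank w) * (e z w)%:R)); last first.
  by move=> w _; rewrite mulrBr !(mulrC (e z w)%:R).
rewrite sumrB -mulr_sumr -natr_deg (bigD1 z) //=.
rewrite mxE eqxx enum_rankK; congr (_ + _).
rewrite [in RHS](bigD1 z) //= ei mulr0 add0r -sumrN; apply: eq_bigr => w wz.
by rewrite mxE (inj_eq enum_rank_inj) (negPf wz) !enum_rankK es mulrN.
Qed.

Lemma lapT_tr (R : realFieldType) (T : finType) (e : rel T) :
  symmetric e -> (lapT R e)^T = lapT R e.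
Proof.
move=> es; apply/matrixP => i j; rewrite !mxE eq_sym es.
by case: eqP => // ->.
Qed.

(* The right kernel of the Laplacian consists of constant vectors, all of which
   annihilate the current [e_x - e_y]: this is the solvability of Kirchhoff's
   equations. *)
Lemma resistance_solution (R : realFieldType) (T : finType) (e : rel T) (x y : T) :
  symmetric e -> irreflexive e -> connected e ->
  exists2 g : T -> R,
    (forall z, laplacian e g z = (z == x)%:R - (z == y)%:R) &
    resistance R e x y = g x - g y.
Proof.
move=> es ei ec; rewrite /resistance.
set b : 'rV[R]_#|T| := _ - _; set v := b *m _.
have vL : v *m lapT R e = b.
  rewrite mulmxKpV // submxE; apply/eqP/rowP => k.
  pose c := (col k (cokermx (lapT R e)))^T.
  have cL : c *m lapT R e = 0.
    by rewrite -(lapT_tr R es) -trmx_mul colE mulmxA mulmx_coker mul0mx trmx0.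
  have cxy : c 0 (enum_rank x) = c 0 (enum_rank y).
    apply: (harmonic_const (g := fun w => c 0 (enum_rank w)) es ec) => z.
    by rewrite -mulmx_lapT // cL mxE.
  rewrite mulmxBl -!rowE !mxE; move: cxy; rewrite !mxE => ->.
  by rewrite subrr.
exists (fun w => v 0 (enum_rank w)) => // z.
by rewrite -mulmx_lapT // vL !mxE /= !(inj_eq enum_rank_inj).
Qed.

(** Two potentials for the same current differ by a harmonic function, that is, a constant. Any
    explicit potential may thus replace the one obtained from [pinvmx]. *)
Lemma resistanceE (R : realFieldType) (T : finType) (e : rel T) (x y : T) (g : T -> R) :
  symmetric e -> irreflexive e -> connected e ->
  (forall z, laplacian e g z = (z == x)%:R - (z == y)%:R) ->
  resistance R e x y = g x - g y.
Proof.
move=> es ei ec gP; have [f fP ->] := resistance_solution R x y es ei ec.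
have := harmonic_const (e := e) (g := fun z => f z - g z) es ec.
move=> /(_ _ x y) H; have {}H : f x - g x = f y - g y.
  by apply: H => z; rewrite laplacianB fP gP subrr.
by lra.
Qed.

Lemma resistance_sym (R : realFieldType) (T : finType) (e : rel T) (x y : T) :
  resistance R e y x = resistance R e x y.
Proof.
rewrite /resistance; set b : 'rV[R]_#|T| := delta_mx _ _ - _.
set b' : 'rV[R]_#|T| := delta_mx _ _ - _.
have -> : b = - b' by rewrite opprB.
by rewrite mulNmx !mxE opprK addrC.
Qed.

Lemma resistance_diag (R : realFieldType) (T : finType) (e : rel T) (x : T) :
  resistance R e x x = 0.
Proof. by rewrite /resistance subrr. Qed.

(** Removes the order on [enum_rank]: by symmetry and the zero diagonal, a full double sum counts
    each unordered pair twice. *)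
Lemma Kf_double (R : realFieldType) (T : finType) (e : rel T) :
  2 * Kf R e = \sum_x \sum_y resistance R e x y.
Proof.
have E : Kf R e =
    \sum_x \sum_(y : T | (enum_rank y < enum_rank x)%N) resistance R e x y.
  rewrite /Kf (exchange_big_dep xpredT) //=.
  by apply: eq_bigr => x _; apply: eq_bigr => y _; exact: resistance_sym.
rewrite mulr_natl mulr2n {2}E -big_split /=; apply: eq_bigr => x _.
rewrite [RHS](bigID (fun y => enum_rank x < enum_rank y)%N) /=; congr (_ + _).
rewrite [RHS](bigD1 x) ?ltnn //= resistance_diag add0r.
apply: eq_bigl => y; rewrite -leqNgt ltn_neqAle andbC.
by rewrite (inj_eq val_inj) (inj_eq enum_rank_inj).
Qed.

(** * Invertibility of L + 2I and the trace of its inverse *)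

Lemma lap_mx_mulE (R : realFieldType) (n m : nat) (e : rel 'I_n) (M : 'M[R]_(n, m)) i j :
  (lap_mx R e *m M) i j = laplacian e (fun k => M k j) i.
Proof.
rewrite mulmxBl mxE mul_diag_mx !mxE natr_deg mulr_suml -sumrB.
by apply: eq_bigr => k _; rewrite !mxE; ring.
Qed.

Lemma lap_mx_tr (R : realFieldType) (n : nat) (e : rel 'I_n) :
  symmetric e -> (lap_mx R e)^T = lap_mx R e.
Proof.
move=> es; rewrite /lap_mx linearB /= tr_diag_mx; congr (_ - _).
by apply/matrixP => i j; rewrite !mxE es.
Qed.

(** A kernel vector [w] satisfies L w = -2 w, so its nonnegative Dirichlet energy equals -4 times
    the sum of its squared entries, which forces [w] to be zero. *)
Lemma lap_mxD2_unit (R : realFieldType) (n : nat) (e : rel 'I_n) :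
  symmetric e -> lap_mx R e + 2%:M \in unitmx.
Proof.
move=> es; rewrite -unitmx_tr -row_free_unit -kermx_eq0; apply/rowV0P => v.
move=> /sub_kermxP v0; pose w := v^T.
have {}v0 : lap_mx R e *m w + 2 *: w = 0.
  by rewrite -mul_scalar_mx -mulmxDl -[LHS]trmxK trmx_mul trmxK v0 trmx0.
have E i : laplacian e (fun k => w k 0) i = - 2 * w i 0.
  by move/matrixP/(_ i 0): v0; rewrite mxE lap_mx_mulE !mxE => /eqP;
    rewrite addr_eq0 => /eqP ->; rewrite mulNr.
have S0 : \sum_i w i 0 ^+ 2 = 0.
  apply/eqP; rewrite eq_le sumr_ge0 ?andbT => [|i _]; last exact: sqr_ge0.
  have := dirichlet_energy (fun k => w k 0) es.
  rewrite (eq_bigr (fun i => - 2 * w i 0 ^+ 2)) => [|i _]; last first.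
    by rewrite E; ring.
  rewrite -mulr_sumr => H.
  have : 0 <= \sum_z \sum_t (e z t)%:R * (w z 0 - w t 0) ^+ 2.
    by do 2![apply: sumr_ge0 => ? _]; rewrite mulr_ge0 ?sqr_ge0.
  by rewrite -H; lra.
apply/rowP => i; rewrite mxE.
have /eqP := psumr_eq0P (fun i _ => sqr_ge0 (w i 0)) S0 (i := i) isT.
by rewrite sqrf_eq0 mxE => /eqP.
Qed.

Lemma horner_char_poly (F : fieldType) (n : nat) (A : 'M[F]_n) (y : F) :
  (char_poly A).[y] = \det (y%:M - A).
Proof.
rewrite -horner_evalE -det_map_mx; congr (\det _); apply/matrixP => i j.
by rewrite !mxE /= /horner_eval hornerD hornerN hornerMn hornerX hornerC.
Qed.

(** The positive integers up to [size (p - q)] are distinct nonzero roots of [p - q], more than its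
    degree allows. Excluding 0 permits the use of [y^-1] in the determinant identity for the
    inverse. *)
Lemma poly_eq_nonzero (F : numFieldType) (p q : {poly F}) :
  (forall y, y != 0 -> p.[y] = q.[y]) -> p = q.
Proof.
move=> pq; apply/eqP; rewrite -subr_eq0; apply/eqP.
pose rs := [seq k.+1%:R : F | k <- iota 0 (size (p - q))].
apply: (@roots_geq_poly_eq0 _ _ rs); last by rewrite size_map size_iota.
- apply/allP => _ /mapP[k _ ->]; rewrite rootE hornerD hornerN pq ?subrr //.
  by rewrite pnatr_eq0.
- rewrite map_inj_uniq ?iota_uniq // => i j /eqP; rewrite eqr_nat.
  by move=> /eqP[].
Qed.

(* Trace is read off the characteristic polynomial of the inverse, whose roots
   are the inverses: [det (y - B^-1) = det (B^-1) y^n det (B - y^-1)]. *)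
Lemma mxtrace_invmx (F : numFieldType) (n : nat) (A : 'M[F]_n) (c : F) (mu : 'I_n -> F) :
  A + c%:M \in unitmx -> char_poly A = \prod_(i < n) ('X - (mu i)%:P) ->
  \tr (invmx (A + c%:M)) = \sum_(i < n) (mu i + c)^-1.
Proof.
move=> uB cA; set B := A + c%:M in uB *.
have detE y : \det (B - y%:M) = \prod_(i < n) (mu i + c - y).
  have -> : B - y%:M = - ((y - c)%:M - A).
    by apply/matrixP => i j; rewrite !mxE; case: (i == j) => /=; ring.
  rewrite -scaleN1r detZ -horner_char_poly cA horner_prod.
  rewrite -[n in _ ^+ n]card_ord -prodr_const -big_split /=.
  by apply: eq_bigr => i _; rewrite !hornerE; ring.
have detB : \det B = \prod_(i < n) (mu i + c).
  by have := detE 0; rewrite raddf0 subr0 => ->; under eq_bigr do rewrite subr0.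
have nz i : mu i + c != 0.
  move: uB; rewrite unitmxE unitfE detB => /prodf_neq0; exact.
(* [char_poly_trace] reads the coefficient of index [n.-1], so the empty matrix is treated apart. *)
have [n0|n_gt0] := posnP n.
  by rewrite /mxtrace !big1 // => i; move: (ltn_ord i); rewrite [X in (_ < X)%N]n0.
have cB : char_poly (invmx B) = \prod_(i < n) ('X - ((mu i + c)^-1)%:P).
  apply: poly_eq_nonzero => y y0; rewrite horner_char_poly horner_prod.
  have -> : y%:M - invmx B = invmx B *m (y *: (B - y^-1%:M)).
    rewrite -scalemxAr mulmxBr mulVmx // mul_mx_scalar scalerBr scalerA divff //.
    by rewrite scale1r scalemx1.
  rewrite det_mulmx det_inv detZ detE detB -prodfV.
  rewrite -[n in _ ^+ n]card_ord -prodr_const -!big_split /=.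
  by apply: eq_bigr => i _; rewrite !hornerE /=; field; rewrite nz y0.
(* The coefficient of index [n.-1] is minus the trace and, by Vieta, also minus the sum of the
   roots. *)
have := char_poly_trace (invmx B) n_gt0; rewrite cB.
pose s := [seq (mu i + c)^-1 | i : 'I_n].
have sz : size s = n by rewrite size_image card_ord.
have := @coefPn_prod_XsubC _ s; rewrite sz -lt0n => /(_ n_gt0).
by rewrite !big_image /= => -> /oppr_inj.
Qed.

Lemma eq_laplacian (R : realFieldType) (T : finType) (e : rel T) (f g : T -> R) z :
  f =1 g -> laplacian e f z = laplacian e g z.
Proof. by move=> fg; apply: eq_bigr => w _; rewrite !fg. Qed.

Lemma laplacianZ (R : realFieldType) (T : finType) (e : rel T) (c : R) (f : T -> R) z :
  laplacian e (fun w => c * f w) z = c * laplacian e f z.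
Proof. by rewrite mulr_sumr; apply: eq_bigr => w _; ring. Qed.

(** * Edge sums and the Green function of one grounded copy *)

Lemma edge_ends_neq (n : nat) (e : rel 'I_n) (f : edge e) :
  ((val f).1 == (val f).2) = false.
Proof.
case: f => -[u v] /= /andP[/= uv _].
by apply/negbTE; rewrite -val_eqE /= neq_ltn uv.
Qed.

(** An edge is stored once, with increasing ends, so evaluating [G] in both directions meets each
    ordered adjacent pair exactly once. *)
Lemma sum_edge (R : realFieldType) (n : nat) (e : rel 'I_n) (G : 'I_n -> 'I_n -> R) :
  symmetric e -> irreflexive e ->
  \sum_(f : edge e) (G (val f).1 (val f).2 + G (val f).2 (val f).1) =
  \sum_i \sum_j (e i j)%:R * G i j.
Proof.
move=> es ei.
have sub_sum F : \sum_(f : edge e) F (val f) = \sum_(p | edge_pred e p) F p :> R.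
  exact/esym/(big_sub (edge_pred e)).
rewrite (sub_sum (fun p => G p.1 p.2 + G p.2 p.1)) big_split /=.
have up (F : 'I_n -> 'I_n -> R) : \sum_(p | edge_pred e p) F p.1 p.2 =
    \sum_(i < n) \sum_(j < n | (i < j)%N) (e i j)%:R * F i j.
  rewrite -(pair_big_dep xpredT (fun i j : 'I_n => (i < j)%N && e i j) F) /=.
  apply: eq_bigr => i _; rewrite big_mkcondr; apply: eq_bigr => j _.
  by case: (e i j); rewrite ?mul1r ?mul0r.
rewrite up (up (fun i j => G j i)) [X in _ + X](exchange_big_dep xpredT) //=.
rewrite -big_split /=; apply: eq_bigr => i _.
rewrite [RHS](bigID (fun j : 'I_n => i < j)%N) /=; congr (_ + _).
rewrite [RHS](bigD1 i) ?ltnn //= ei mul0r add0r.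
apply: eq_big => [j|j _]; last by rewrite es.
by rewrite -leqNgt ltn_neqAle andbC.
Qed.

(* Value at a vertex of [S(G)] of the extension of a potential on [G] that is
   harmonic at the subdivision vertices. *)
Definition subdiv_extend (R : realFieldType) (n : nat) (e : rel 'I_n) (phi : 'I_n -> R)
  (p : 'I_n + edge e) : R :=
  match p with
  | inl u => phi u
  | inr f => (phi (val f).1 + phi (val f).2) / 2
  end.

(* With [K = (L + 2)^-1], this is the inverse of the Laplacian of a copy of
   [S(G)] whose original vertices are all joined to a grounded root: the Schur
   complement of its subdivision block [2 I] is [(L + 2) / 2]. *)
Definition copy_green (R : realFieldType) (n : nat) (e : rel 'I_n) (K : 'M[R]_n)
  (p q : 'I_n + edge e) : R :=
  2 * subdiv_extend (fun u => subdiv_extend (K u) q) p +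
  (if p is inr f then (inr f == q)%:R / 2 else 0).

(** A vertex contributes its own value and half of it to each incident subdivision vertex. *)
Lemma sum_subdiv_extend (R : realFieldType) (n : nat) (e : rel 'I_n) (phi : 'I_n -> R) :
  symmetric e -> irreflexive e ->
  \sum_(p : 'I_n + edge e) subdiv_extend phi p =
  \sum_u (1 + (deg e u)%:R / 2) * phi u.
Proof.
move=> es ei; rewrite big_sumType /=.
rewrite (eq_bigr (fun f : edge e => (phi (val f).1 / 2 + phi (val f).2 / 2)));
  last by move=> f _; ring.
rewrite (sum_edge (fun i j => phi i / 2) es ei) -big_split /=.
by apply: eq_bigr => u _; rewrite natr_deg -mulr_suml; ring.
Qed.

Lemma sum_deg (R : realFieldType) (n : nat) (e : rel 'I_n) :
  symmetric e -> irreflexive e ->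
  \sum_u (deg e u)%:R = 2 * #|{: edge e}|%:R :> R.
Proof.
move=> es ei; rewrite (eq_bigr (fun i => \sum_j (e i j)%:R * 1)).
  rewrite -(sum_edge (fun _ _ => 1) es ei) sumr_const.
  by rewrite -[LHS]mulr_natr.
by move=> i _; rewrite natr_deg; under [RHS]eq_bigr do rewrite mulr1.
Qed.

(** The Laplacian kills constants, so Q 1 = 2 1; applying the inverse gives the row sums. *)
Lemma invmx_lap_mxD2_row (R : realFieldType) (n : nat) (e : rel 'I_n) (u : 'I_n) :
  symmetric e -> \sum_v invmx (lap_mx R e + 2%:M) u v = 2^-1.
Proof.
move=> es; set Q := _ + _; have uQ : Q \in unitmx by exact: lap_mxD2_unit.
have : Q *m const_mx 1 = 2 *: const_mx 1 :> 'cV[R]_n.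
  apply/colP => i; rewrite mulmxDl mxE lap_mx_mulE mul_scalar_mx !mxE.
  by rewrite /laplacian big1 ?add0r // => w _; rewrite !mxE subrr mulr0.
move/(congr1 (mulmx (invmx Q))); rewrite mulmxA mulVmx // mul1mx -scalemxAr.
move/colP/(_ u); rewrite !mxE; under eq_bigr do rewrite mxE mulr1.
by move=> H; lra.
Qed.

Lemma invmx_lap_mxD2_sym (R : realFieldType) (n : nat) (e : rel 'I_n) u v :
  symmetric e ->
  invmx (lap_mx R e + 2%:M) u v = invmx (lap_mx R e + 2%:M) v u.
Proof.
by move=> es; rewrite -[in RHS](lap_mx_tr R es) -(tr_scalar_mx n 2) -raddfD
  -trmx_inv mxE /= tr_scalar_mx.
Qed.

(** For an original vertex [q] this is an entry of Q K = I; for a subdivision vertex both sides are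
    averages over the two ends of the edge. *)
Lemma invmx_lap_mxD2_laplacian (R : realFieldType) (n : nat) (e : rel 'I_n)
  (q : 'I_n + edge e) (u : 'I_n) :
  symmetric e -> let K := invmx (lap_mx R e + 2%:M) in
  laplacian e (fun w => subdiv_extend (K w) q) u + 2 * subdiv_extend (K u) q =
  subdiv_extend (fun v => (u == v)%:R) q.
Proof.
move=> es K.
have E v : laplacian e (fun w => K w v) u + 2 * K u v = (u == v)%:R.
  have := mulmxV (lap_mxD2_unit R es); move/matrixP/(_ u v).
  by rewrite mulmxDl mul_scalar_mx mxE lap_mx_mulE !mxE.
case: q => [v|f] //=; rewrite -!E.
rewrite (eq_laplacian _ (g := fun w => 2^-1 * (K w (val f).1 + K w (val f).2))).
  by rewrite laplacianZ laplacianD; field.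
by move=> w; rewrite mulrC.
Qed.

(** Current conservation: the unit injected at [q] leaves entirely through the edges to the grounded
    root. *)
Lemma copy_green_root (R : realFieldType) (n : nat) (e : rel 'I_n) (q : 'I_n + edge e) :
  symmetric e -> let K := invmx (lap_mx R e + 2%:M) in
  \sum_u copy_green K (inl u) q = 1.
Proof.
move=> es K; rewrite /copy_green /=.
have E v : \sum_u K u v = 2^-1.
  by under eq_bigr do rewrite invmx_lap_mxD2_sym //; exact: invmx_lap_mxD2_row.
under eq_bigr do rewrite addr0.
case: q => [v|f] /=; rewrite -mulr_sumr ?E; first by field.
by rewrite -mulr_suml big_split /= !E; field.
Qed.

(** Kirchhoff's law at an original vertex, the first term being the current to the grounded root.
    Halving at midpoints cancels the factor 2 in [copy_green], which leaves the Laplacian of [phi];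
    the correction at [q = inr f] absorbs the half unit seen by each end of [f]. *)
Lemma copy_green_vertex (R : realFieldType) (n : nat) (e : rel 'I_n)
  (q : 'I_n + edge e) (u : 'I_n) :
  symmetric e -> irreflexive e -> let K := invmx (lap_mx R e + 2%:M) in
  copy_green K (inl u) q +
  \sum_(f : edge e) ((u == (val f).1) || (u == (val f).2))%:R *
     (copy_green K (inl u) q - copy_green K (inr f) q) = (inl u == q)%:R.
Proof.
move=> es ei K; pose phi w := subdiv_extend (K w) q.
have lapE : laplacian e phi u + 2 * phi u = subdiv_extend (fun v => (u == v)%:R) q.
  exact: invmx_lap_mxD2_laplacian.
rewrite /copy_green /= -/(phi _) addr0.
pose c (f : edge e) : R := ((u == (val f).1) || (u == (val f).2))%:R.
(* [G] is supported on pairs starting at [u], so [sum_edge] turns the sum over edges incident to [u]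
   into the Laplacian at [u]. *)
pose G i j := (u == i)%:R * (phi i - phi j).
rewrite (eq_bigr (fun f : edge e => G (val f).1 (val f).2 + G (val f).2 (val f).1
  - c f * (inr f == q)%:R / 2)); last first.
  move=> f _; rewrite -/(phi _) -/(phi _) /G /c; have := edge_ends_neq f.
  have [<-|_] := eqVneq u (val f).1; last have [<-|_] := eqVneq u (val f).2.
  - by move=> -> /=; field.
  - by move=> _ /=; field.
  - by move=> _ /=; field.
rewrite sumrB (sum_edge G es ei).
have -> : \sum_i \sum_j (e i j)%:R * G i j = laplacian e phi u.
  rewrite (bigD1 u) //= [X in _ + X]big1 ?addr0 => [|i iu].
    by apply: eq_bigr => j _; rewrite /G eqxx mul1r.
  by apply: big1 => j _; rewrite /G eq_sym (negPf iu) mul0r mulr0.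
rewrite addrA [2 * _ + _]addrC lapE.
case: (q) => [v|g] /=.
  rewrite big1 ?subr0 => [//|f _]; by rewrite mulr0 mul0r.
rewrite (bigD1 g) //= [X in _ - (_ + X)]big1 => [|f fg].
  rewrite /c eqxx /=; have := edge_ends_neq g.
  have [<-|_] := eqVneq u (val g).1; last by case: eqP => _ _ /=; field.
  by move=> -> /=; field.
have -> : (inr f == inr g :> 'I_n + edge e) = (f == g) by [].
by rewrite (negPf fg) mulr0 mul0r.
Qed.

(** Kirchhoff's law at a subdivision vertex: the averaged part is harmonic there, and the correction
    1/2 sends its unit out over two edges. *)
Lemma copy_green_edge (R : realFieldType) (n : nat) (e : rel 'I_n) (K : 'M[R]_n)
  (q : 'I_n + edge e) (f : edge e) :
  (copy_green K (inr f) q - copy_green K (inl (val f).1) q) +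
  (copy_green K (inr f) q - copy_green K (inl (val f).2) q) = (inr f == q)%:R.
Proof. by rewrite /copy_green /=; field. Qed.

(** At the midpoint of an edge the four entries of [K] on its ends appear: summed over edges, the
    diagonal ones form the trace with the degree matrix and the mixed ones the trace with the
    adjacency matrix. *)
Lemma sum_copy_green_diag (R : realFieldType) (n : nat) (e : rel 'I_n) :
  symmetric e -> irreflexive e -> let K := invmx (lap_mx R e + 2%:M) in
  \sum_(p : 'I_n + edge e) copy_green K p p =
  2 * \tr K + (\tr (K *m adj_mx R e) + \tr (K *m deg_mx R e)) / 2
  + #|{: edge e}|%:R / 2.
Proof.
move=> es ei K; rewrite big_sumType /= /copy_green /=.
rewrite (eq_bigr (fun u => 2 * K u u)); last by move=> u _; rewrite addr0.
rewrite -mulr_sumr -/(mxtrace K) -addrA; congr (_ + _).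
rewrite (eq_bigr (fun f : edge e =>
    ((K (val f).1 (val f).1 + K (val f).1 (val f).2) / 2 +
     (K (val f).2 (val f).2 + K (val f).2 (val f).1) / 2) + 2^-1)); last first.
  by move=> f _; rewrite eqxx /=; field.
rewrite big_split /= (sum_edge (fun i j => (K i i + K i j) / 2) es ei).
rewrite sumr_const -[2^-1 *+ _]mulr_natl; congr (_ + _).
rewrite -mxtraceD -mulmxDr mulr_suml; apply: eq_bigr => i _.
rewrite mulmxDr mxE mul_mx_diag !mxE natr_deg mulr_sumr -big_split /= mulr_suml.
by apply: eq_bigr => j _; rewrite mxE es; ring.
Qed.

(** Summing both arguments weights [K] by 1 + d/2 on each side. Constant row and column sums
    evaluate every term except the quadratic form in the degrees; the 5/2 is 2 from the two mixed
    terms plus 1/2 from the midpoint corrections. *)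
Lemma sum_copy_green (R : realFieldType) (n : nat) (e : rel 'I_n) :
  symmetric e -> irreflexive e -> let K := invmx (lap_mx R e + 2%:M) in
  \sum_(p : 'I_n + edge e) \sum_q copy_green K p q =
  n%:R + 5 * #|{: edge e}|%:R / 2 +
  ((deg_vec R e)^T *m K *m deg_vec R e) 0 0 / 2.
Proof.
move=> es ei K; pose d u : R := (deg e u)%:R.
rewrite /copy_green; under eq_bigr do rewrite big_split /=.
rewrite big_split /=.
have -> : \sum_(p : 'I_n + edge e) \sum_(q : 'I_n + edge e)
     (if p is inr f then (inr f == q)%:R / 2 else 0) = #|{: edge e}|%:R / 2 :> R.
  rewrite big_sumType /= big1 ?add0r => [|u _]; last by rewrite big1.
  rewrite (eq_bigr (fun=> 2^-1)) ?sumr_const -?[2^-1 *+ _]mulr_natl // => f _.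
  rewrite (bigD1 (inr f)) //= eqxx big1 ?addr0 ?mul1r // => q.
  by rewrite eq_sym => /negPf ->; rewrite mul0r.
rewrite exchange_big /=; under eq_bigr do rewrite -mulr_sumr sum_subdiv_extend //.
rewrite -mulr_sumr exchange_big /=.
under eq_bigr do rewrite -mulr_sumr sum_subdiv_extend //.
have pKp : ((deg_vec R e)^T *m K *m deg_vec R e) 0 0 =
    \sum_u d u * \sum_v d v * K u v.
  rewrite -mulmxA mxE; apply: eq_bigr => u _; rewrite !mxE; congr (_ * _).
  by apply: eq_bigr => v _; rewrite !mxE mulrC.
have row1 u : \sum_v K u v = 2^-1 by exact: invmx_lap_mxD2_row.
have col1 : \sum_u \sum_v d v * K u v = \sum_v d v / 2.
  rewrite exchange_big; apply: eq_bigr => v _; rewrite -mulr_sumr; congr (_ * _).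
  by under eq_bigr do rewrite invmx_lap_mxD2_sym //; exact: row1.
rewrite pKp (eq_bigr (fun u => 2^-1 + 2^-1 * (\sum_v d v * K u v) + d u / 4
   + 4^-1 * (d u * \sum_v d v * K u v))); last first.
  move=> u _; rewrite (eq_bigr (fun v => K u v + 2^-1 * (d v * K u v))).
    by rewrite big_split /= row1 -mulr_sumr -/(d u); field.
  by move=> v _; rewrite -/(d v); field.
rewrite !big_split /= -!mulr_sumr col1 -!mulr_suml (sum_deg R es ei).
by rewrite sumr_const card_ord -[2^-1 *+ _]mulr_natl; field.
Qed.

(** * Potentials and resistances on the corona *)

Lemma sum_cvert (R : realFieldType) (n1 n2 : nat) (e2 : rel 'I_n2)
  (F : cvert n1 e2 -> R) :
  \sum_x F x =
  \sum_(a < n1) F (inl a) + \sum_(i < n1) \sum_(p : 'I_n2 + edge e2) F (inr (i, p)).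
Proof.
rewrite /cvert big_sumType /=; congr (_ + _).
by rewrite pair_bigA /=; apply: eq_bigr => -[].
Qed.

Definition corona_root (n1 n2 : nat) (e2 : rel 'I_n2) (x : cvert n1 e2) : 'I_n1 :=
  match x with inl a => a | inr (i, _) => i end.

(** Green function of the corona with all of G1 grounded: the copies decouple, and arguments in G1
    give 0. *)
Definition corona_green (R : realFieldType) (n1 n2 : nat) (e2 : rel 'I_n2)
  (K : 'M[R]_n2) (x y : cvert n1 e2) : R :=
  match x, y with
  | inr (i, p), inr (j, q) => (i == j)%:R * copy_green K p q
  | _, _ => 0
  end.

Lemma corona_rel_sym (n1 n2 : nat) (e1 : rel 'I_n1) (e2 : rel 'I_n2) :
  symmetric e1 -> symmetric (corona_rel e1 e2).
Proof. by move=> es [a|[i [u|f]]] [b|[j [v|g]]] //=. Qed.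

Lemma corona_rel_irr (n1 n2 : nat) (e1 : rel 'I_n1) (e2 : rel 'I_n2) :
  irreflexive e1 -> irreflexive (corona_rel e1 e2).
Proof. by move=> ei [a|[i [u|f]]] //=. Qed.

Lemma corona_connected (n1 n2 : nat) (e1 : rel 'I_n1) (e2 : rel 'I_n2) :
  symmetric e1 -> connected e1 -> connected (corona_rel e1 e2).
Proof.
move=> es ec.
have csym : connect_sym (corona_rel e1 e2).
  by apply: sym_connect_sym; exact: corona_rel_sym.
have base a b : connect (corona_rel e1 e2) (inl a) (inl b).
  have /connectP[p + ->] := ec a b.
  elim: p a => [|c p IH] a /=; first by rewrite connect0.
  case/andP=> ac /IH; apply: connect_trans.
  exact: (@connect1 _ (corona_rel e1 e2) (inl a) (inl c)).
have vert i u : connect (corona_rel e1 e2) (inr (i, inl u)) (inl i).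
  by apply: connect1 => /=.
have root x : connect (corona_rel e1 e2) x (inl (corona_root x)).
  case: x => [a|[i [u|f]]] /=; [exact: connect0 | exact: vert |].
  apply: connect_trans (vert i (val f).1).
  by apply: connect1; rewrite /= !eqxx.
move=> x y; apply: connect_trans (root x) _.
by apply: connect_trans (base _ (corona_root y)) _; rewrite csym root.
Qed.

Lemma laplacian_corona_base (R : realFieldType) (n1 n2 : nat) (e1 : rel 'I_n1)
  (e2 : rel 'I_n2) (g : cvert n1 e2 -> R) (a : 'I_n1) :
  laplacian (corona_rel e1 e2) g (inl a) =
  laplacian e1 (fun b => g (inl b)) a + \sum_u (g (inl a) - g (inr (a, inl u))).
Proof.
rewrite /laplacian sum_cvert /=; congr (_ + _).
rewrite (bigD1 a) //= [X in _ + X]big1 ?addr0 => [|i ia].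
  rewrite big_sumType /= [X in _ + X]big1 ?addr0 => [|f _]; last by rewrite mul0r.
  by apply: eq_bigr => u _; rewrite eqxx mul1r.
rewrite big_sumType /= !big1 ?addr0 // => [f|u] _; first by rewrite mul0r.
by rewrite eq_sym (negPf ia) mul0r.
Qed.

Lemma laplacian_corona_vertex (R : realFieldType) (n1 n2 : nat) (e1 : rel 'I_n1)
  (e2 : rel 'I_n2) (g : cvert n1 e2 -> R) (i : 'I_n1) (u : 'I_n2) :
  laplacian (corona_rel e1 e2) g (inr (i, inl u)) =
  g (inr (i, inl u)) - g (inl i) +
  \sum_(f : edge e2) ((u == (val f).1) || (u == (val f).2))%:R *
    (g (inr (i, inl u)) - g (inr (i, inr f))).
Proof.
rewrite /laplacian sum_cvert /=; congr (_ + _).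
  rewrite (bigD1 i) //= eqxx mul1r big1 ?addr0 // => a ai.
  by rewrite (negPf ai) mul0r.
rewrite (bigD1 i) //= [X in _ + X]big1 ?addr0 => [|j ji].
  rewrite big_sumType /= big1 ?add0r => [|v _]; last by rewrite mul0r.
  by apply: eq_bigr => f _; rewrite eqxx.
rewrite big_sumType /= !big1 ?addr0 // => [f|v] _; last by rewrite mul0r.
by rewrite eq_sym (negPf ji) mul0r.
Qed.

Lemma laplacian_corona_edge (R : realFieldType) (n1 n2 : nat) (e1 : rel 'I_n1)
  (e2 : rel 'I_n2) (g : cvert n1 e2 -> R) (i : 'I_n1) (f : edge e2) :
  laplacian (corona_rel e1 e2) g (inr (i, inr f)) =
  (g (inr (i, inr f)) - g (inr (i, inl (val f).1))) +
  (g (inr (i, inr f)) - g (inr (i, inl (val f).2))).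
Proof.
rewrite /laplacian sum_cvert /= big1 ?add0r => [|a _]; last by rewrite mul0r.
rewrite (bigD1 i) //= [X in _ + X]big1 ?addr0 => [|j ji].
  rewrite big_sumType /= [X in _ + X]big1 ?addr0 => [|h _]; last by rewrite mul0r.
  have ne := edge_ends_neq f.
  rewrite (bigD1 (val f).1) //= !eqxx /= mul1r; congr (_ + _).
  rewrite (bigD1 (val f).2) /=; last by rewrite eq_sym ne.
  rewrite eqxx orbT mul1r big1 ?addr0 // => v /andP[/negPf -> /negPf ->].
  by rewrite mul0r.
rewrite big_sumType /= !big1 ?addr0 // => [h|u] _; first by rewrite mul0r.
by rewrite (negPf ji) mul0r.
Qed.

(** Inside the copy of [x] the three Kirchhoff laws of [copy_green] apply, and the root collects the
    whole unit current. If [x] lies in G1 the potential is zero and source and sink coincide. *)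
Lemma laplacian_corona_green (R : realFieldType) (n1 n2 : nat) (e1 : rel 'I_n1)
  (e2 : rel 'I_n2) (x z : cvert n1 e2) :
  symmetric e2 -> irreflexive e2 -> let K := invmx (lap_mx R e2 + 2%:M) in
  laplacian (corona_rel e1 e2) (fun w => corona_green K w x) z =
  (z == x)%:R - (z == inl (corona_root x))%:R.
Proof.
move=> es ei K.
have neq_lr (a : 'I_n1) q : (inl a == inr q :> cvert n1 e2) = false by [].
have neq_rl (a : 'I_n1) q : (inr q == inl a :> cvert n1 e2) = false by [].
have eq_ll (a b : 'I_n1) : (inl a == inl b :> cvert n1 e2) = (a == b) by [].
have eq_rr (i j : 'I_n1) (p q : 'I_n2 + edge e2) :
  (inr (i, p) == inr (j, q) :> cvert n1 e2) = (i == j) && (p == q) by [].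
case: x => [a|[j q]].
  rewrite /= subrr /laplacian big1 // => w _.
  by case: z w => [?|[? ?]] [?|[? ?]]; rewrite /= subrr mulr0.
case: z => [a|[i [u|f]]].
- rewrite laplacian_corona_base neq_lr eq_ll /= sub0r.
  rewrite /laplacian big1 => [|b _]; last by rewrite subrr mulr0.
  by rewrite add0r sumrB big1 // -mulr_sumr copy_green_root // mulr1 sub0r.
- rewrite laplacian_corona_vertex neq_rl eq_rr /= subr0.
  have [_|_] := eqVneq i j; last first.
    by rewrite !mul0r subr0 add0r big1 // => f _; rewrite !mul0r subrr mulr0.
  rewrite -(copy_green_vertex R q u es ei) mul1r subr0; congr (_ + _).
  by apply: eq_bigr => f _; rewrite !mul1r.
- rewrite laplacian_corona_edge neq_rl eq_rr /= subr0.
  have [_|_] := eqVneq i j; last by rewrite !mul0r subrr addr0.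
  by rewrite -(copy_green_edge K q f) !mul1r.
Qed.

(** A potential constant on each copy and its root drives no current off G1. *)
Lemma laplacian_corona_lift (R : realFieldType) (n1 n2 : nat) (e1 : rel 'I_n1)
  (e2 : rel 'I_n2) (g : 'I_n1 -> R) (z : cvert n1 e2) :
  laplacian (corona_rel e1 e2) (fun w => g (corona_root w)) z =
  if z is inl a then laplacian e1 g a else 0.
Proof.
case: z => [a|[i [u|f]]].
- by rewrite laplacian_corona_base /= big1 ?addr0 // => u _; rewrite subrr.
- rewrite laplacian_corona_vertex /= subrr add0r big1 // => f _.
  by rewrite mulr0.
- by rewrite laplacian_corona_edge /= subrr addr0.
Qed.

(* The copies hang at cut vertices: a unit current from [x] to [y] flows inside
   the copies to the roots, and through [G1] from root to root. *)
Lemma resistance_corona (R : realFieldType) (n1 n2 : nat) (e1 : rel 'I_n1)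
  (e2 : rel 'I_n2) (x y : cvert n1 e2) :
  symmetric e1 -> irreflexive e1 -> connected e1 ->
  symmetric e2 -> irreflexive e2 -> let K := invmx (lap_mx R e2 + 2%:M) in
  resistance R (corona_rel e1 e2) x y =
  corona_green K x x - corona_green K x y - corona_green K y x + corona_green K y y +
  resistance R e1 (corona_root x) (corona_root y).
Proof.
move=> es1 ei1 ec1 es2 ei2 K.
have [g gP ->] := resistance_solution R (corona_root x) (corona_root y) es1 ei1 ec1.
rewrite (@resistanceE R _ (corona_rel e1 e2) x y
  (fun w => corona_green K w x - corona_green K w y + g (corona_root w))).
- by ring.
- exact: corona_rel_sym.
- exact: corona_rel_irr.
- exact: corona_connected.
move=> z; rewrite laplacianD laplacianB !laplacian_corona_green //.
rewrite laplacian_corona_lift; case: z => [a|q]; last by rewrite /=; ring.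
rewrite gP.
have eq_ll (b c : 'I_n1) : (inl b == inl c :> cvert n1 e2) = (b == c) by [].
by rewrite !eq_ll; ring.
Qed.

(** * Summation over pairs of corona vertices *)

Lemma sum_corona_root (R : realFieldType) (n1 n2 : nat) (e2 : rel 'I_n2) (F : 'I_n1 -> R) :
  \sum_(x : cvert n1 e2) F (corona_root x) =
  (1 + n2 + #|{: edge e2}|)%:R * \sum_i F i.
Proof.
rewrite sum_cvert /=.
under [X in _ + X]eq_bigr do rewrite sumr_const card_sum card_ord -mulr_natl.
by rewrite -mulr_sumr -addnA [in RHS]natrD mulrDl mul1r.
Qed.

Lemma sum_corona_green_diag (R : realFieldType) (n1 n2 : nat) (e2 : rel 'I_n2) (K : 'M[R]_n2) :
  \sum_(x : cvert n1 e2) corona_green K x x =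
  n1%:R * \sum_(p : 'I_n2 + edge e2) copy_green K p p.
Proof.
rewrite sum_cvert /= big1 ?add0r //.
rewrite (eq_bigr (fun=> \sum_(p : 'I_n2 + edge e2) copy_green K p p)).
  by rewrite sumr_const card_ord -[LHS]mulr_natl.
by move=> i _; apply: eq_bigr => p _; rewrite eqxx mul1r.
Qed.

Lemma sum_corona_green (R : realFieldType) (n1 n2 : nat) (e2 : rel 'I_n2) (K : 'M[R]_n2) :
  \sum_(x : cvert n1 e2) \sum_(y : cvert n1 e2) corona_green K x y =
  n1%:R * \sum_(p : 'I_n2 + edge e2) \sum_q copy_green K p q.
Proof.
rewrite sum_cvert /= big1 ?add0r => [|a _]; last by rewrite big1.
rewrite (eq_bigr (fun=> \sum_(p : 'I_n2 + edge e2) \sum_q copy_green K p q)).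
  by rewrite sumr_const card_ord -[LHS]mulr_natl.
move=> i _; apply: eq_bigr => p _; rewrite sum_cvert /= big1 ?add0r //.
rewrite (bigD1 i) //= [X in _ + X]big1 ?addr0 => [|j ji].
  by apply: eq_bigr => q _; rewrite eqxx mul1r.
by apply: big1 => q _; rewrite eq_sym (negPf ji) mul0r.
Qed.

(** Each diagonal Green term is repeated once per corona vertex, n1 N times; cross terms survive
    only within one copy; each pair of roots comes from N^2 pairs of vertices. *)
Lemma Kf_corona (R : realFieldType) (n1 n2 : nat) (e1 : rel 'I_n1) (e2 : rel 'I_n2) :
  symmetric e1 -> irreflexive e1 -> connected e1 ->
  symmetric e2 -> irreflexive e2 ->
  let K := invmx (lap_mx R e2 + 2%:M) in
  let N := (1 + n2 + #|{: edge e2}|)%:R in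
  Kf R (corona_rel e1 e2) =
  n1%:R ^+ 2 * N * \sum_(p : 'I_n2 + edge e2) copy_green K p p
  - n1%:R * \sum_(p : 'I_n2 + edge e2) \sum_q copy_green K p q + N ^+ 2 * Kf R e1.
Proof.
move=> es1 ei1 ec1 es2 ei2 K N.
pose H : cvert n1 e2 -> cvert n1 e2 -> R := corona_green K.
have cardC : (\sum_(x : cvert n1 e2) 1 : R) = n1%:R * N.
  by rewrite (sum_corona_root e2 (fun=> 1)) sumr_const card_ord mulrC.
have S x : \sum_y resistance R (corona_rel e1 e2) x y =
    n1%:R * N * H x x + \sum_y H y y - \sum_y H x y - \sum_y H y x
    + N * \sum_b resistance R e1 (corona_root x) b.
  rewrite -sum_corona_root -cardC mulr_suml -big_split /= -!sumrB -big_split /=.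
  apply: eq_bigr => y _; rewrite resistance_corona // mul1r; congr (_ + _).
  by rewrite addrAC; congr (_ + _); rewrite addrAC.
apply: (@mulfI _ 2); first by rewrite pnatr_eq0.
rewrite Kf_double (eq_bigr _ (fun x _ => S x)) big_split /=.
rewrite (sum_corona_root e2 (fun a => N * \sum_b resistance R e1 a b)).
rewrite -mulr_sumr -Kf_double !sumrB big_split /= -mulr_sumr.
rewrite [X in _ - X + _]exchange_big /= [X in _ + X - _ - _]
  (_ : _ = n1%:R * N * \sum_y H y y).
  by rewrite sum_corona_green_diag sum_corona_green -/N; ring.
by rewrite -cardC mulr_suml; under [RHS]eq_bigr do rewrite mul1r.
Qed.

Theorem theorem4p1 (R : realFieldType) (n1 n2 : nat)
  (e1 : rel 'I_n1) (e2 : rel 'I_n2) (mu : 'I_n2 -> R) :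
  (0 < n1)%N ->
  symmetric e1 -> irreflexive e1 -> connected e1 ->
  symmetric e2 -> irreflexive e2 ->
  (* mu_1, ..., mu_n2 are the Laplacian eigenvalues of G2 (with multiplicity) *)
  char_poly (lap_mx R e2) = \prod_(i < n2) ('X - (mu i)%:P) ->
  let m2 := #|{: edge e2}| in
  let Q := lap_mx R e2 + 2%:M in
  let Qi := invmx Q in
  let pi := deg_vec R e2 in
  Kf R (corona_rel e1 e2) =
    (n1 * (1 + n2 + m2))%:R *
      ( (n1 * m2)%:R / 2
      + n1%:R / 2 * (\tr (Qi *m adj_mx R e2) + \tr (Qi *m deg_mx R e2))
      + 2 * n1%:R * \sum_(i < n2) (mu i + 2)^-1
      + (m2 + n2 + 1)%:R / n1%:R * Kf R e1 )
    - n1%:R / 2 * (pi^T *m Qi *m pi) 0 0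
    - (5 * n1 * m2 + 2 * n1 * n2)%:R / 2.
Proof.
move=> n1_gt0 es1 ei1 ec1 es2 ei2 cL m2 Q Qi pi.
have n1_neq0 : n1%:R != 0 :> R by rewrite pnatr_eq0 -lt0n.
rewrite Kf_corona // sum_copy_green_diag // sum_copy_green //.
(* Folding the eigenvalue sum back into the trace of [Qi] expresses both sides in the same
   quantities, so only field arithmetic with n1 nonzero remains. *)
rewrite -(mxtrace_invmx (lap_mxD2_unit R es2) cL) -/Q -/Qi -/pi -/m2.
by rewrite !(natrM, natrD); field.
Qed.
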